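(* There is a tight simplex of $24$ points in $\mathbb{O}\mathbb{P}^2$. In fact, there is such a tight simplex with cyclic symmetry, i.e., one mapped to itself by the isometry of $\mathbb{O}\mathbb{P}^2$ induced by the cyclic shift $\sigma(a,b,c)=(b,c,a)$ (conjugation of projection matrices by the corresponding permutation matrix).
   Context: $\mathbb{O}\mathbb{P}^2$ is the set of $3\times3$ octonionic Hermitian matrices $\Pi$ with $\Pi^2=\Pi$ and $\operatorname{Tr}\Pi=1$ (each of the form $(a,b,c)^t(\bar a,\bar b,\bar c)$), with inner product $\langle A,B\rangle=\operatorname{Re}\operatorname{Tr}(AB)$. A tight simplex of $N$ points in $\mathbb{O}\mathbb{P}^2$ is a set of $N$ distinct points $\Pi_1,\dots,\Pi_N$ with $\langle\Pi_i,\Pi_j\rangle=\frac{N-3}{3(N-1)}$ for all $i\ne j$. *)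

(* Defs.v *)
From HB Require Import structures.
From mathcomp Require Import all_boot all_order all_algebra.
From mathcomp Require Import reals.
Set Implicit Arguments. Unset Strict Implicit. Unset Printing Implicit Defensive.
Import Order.TTheory GRing.Theory Num.Theory.
Local Open Scope ring_scope.

Section Octonions.
Variable R : realType.

(* Cayley--Dickson construction: (a,b)(c,d) = (ac - conj(d) b, d a + b conj(c)),
   conj(a,b) = (conj a, -b). *)
Definition cpx := (R * R)%type.
Definition cmul (x y : cpx) : cpx :=
  (x.1 * y.1 - y.2 * x.2, y.2 * x.1 + x.2 * y.1).
Definition cconj (x : cpx) : cpx := (x.1, - x.2).

Definition quat := (cpx * cpx)%type.
Definition qmul (x y : quat) : quat :=
  (cmul x.1 y.1 - cmul (cconj y.2) x.2, cmul y.2 x.1 + cmul x.2 (cconj y.1)).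
Definition qconj (x : quat) : quat := (cconj x.1, - x.2).

Definition oct := (quat * quat)%type.
Definition omul (x y : oct) : oct :=
  (qmul x.1 y.1 - qmul (qconj y.2) x.2, qmul y.2 x.1 + qmul x.2 (qconj y.1)).
Definition oconj (x : oct) : oct := (qconj x.1, - x.2).
Definition oone : oct := (((1, 0), (0, 0)), ((0, 0), (0, 0))).
Definition ore (x : oct) : R := x.1.1.1.

Definition omx := 'M[oct]_3.
Definition omxmul (A B : omx) : omx := \matrix_(i, j) \sum_(k < 3) omul (A i k) (B k j).
Definition otr (A : omx) : oct := \sum_(i < 3) A i i.
Definition ohermitian (A : omx) : Prop := forall i j, A j i = oconj (A i j).

Definition is_OP2 (P : omx) : Prop :=
  ohermitian P /\ omxmul P P = P /\ otr P = oone.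

Definition oinner (A B : omx) : R := ore (otr (omxmul A B)).

Definition tight_simplex (N : nat) (P : 'I_N -> omx) : Prop :=
  (forall i, is_OP2 (P i)) /\ injective P /\
  (forall i j, i != j ->
     oinner (P i) (P j) = (N%:R - 3) / (3 * (N%:R - 1))).

(* isometry induced by sigma(a,b,c) = (b,c,a): (sigma P)_{ij} = P_{i+1,j+1} (mod 3),
   i.e. conjugation by the corresponding permutation matrix *)
Definition cyc3 (i : 'I_3) : 'I_3 := ordS i.
Definition cyc_shift (A : omx) : omx := \matrix_(i, j) A (cyc3 i) (cyc3 j).

End Octonions.

(* Main.v *)
Require Import Defs.
From HB Require Import structures.
From Stdlib Require Import ZArith.
From mathcomp Require Import all_boot all_order all_algebra.
From mathcomp Require Import reals.
From mathcomp Require Import boolp classical_sets functions topology normedtype sequences.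
From mathcomp Require Import interval_inference.
From mathcomp Require Import zify ssrZ ring lra.
Set Implicit Arguments. Unset Strict Implicit. Unset Printing Implicit Defensive.
Import Order.TTheory GRing.Theory Num.Theory.
Import numFieldNormedType.Exports.
Local Open Scope ring_scope.

(** The simplex is a single regular orbit of a group of order 24, the product of
    the cyclic shift and a dihedral group D of order 8 inside G_2 acting on all
    matrix entries. Since the group acts by isometries, it suffices to find one
    projection P with <P, gP> = 7/23 for every g <> 1.

    As a D-module, the octonions are the regular representation: e_2, e_5, e_7
    carry the three nontrivial linear characters, and e_1, e_4, e_3, e_6 carry two
    copies of the 2-dimensional one. The inner product conditions say that P has
    prescribed weight in each isotypic component, so they become a few quadratic
    equations; after using up the centralizer of the group to fix a gauge, these
    and rank-one-ness form a square system of 18 quadratic equations in 18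
    unknowns with an isolated real root. Its existence near a rational
    approximation is certified by a Newton-Kantorovich argument: for a quadratic
    map F, F x - F y = DF((x + y)/2) (x - y) holds exactly, so x |-> x - A (F x)
    is a contraction of a small cube as soon as A is close to the inverse of DF
    there, which reduces to finitely many integer inequalities. *)

(** * A Newton-Kantorovich theorem *)

(* Makes matrices a [completeNormedModType]. *)
HB.instance Definition _ (R : realType) (m n : nat) :=
  Uniform_isComplete.Build 'M[R]_(m, n) (@cauchy_cvg 'M[R]_(m, n)).

Lemma rV_normP (R : realType) (n : nat) (v : 'rV[R]_n) (c : R) : 0 <= c ->
  reflect (forall i, `|v 0 i| <= c) (`|v| <= c).
Proof.
move=> c0; rewrite [`|v|]/Num.Def.normr /= mx_normrE.
apply: (iffP (bigmax_leP _ _ _ _)) => [[_ h] i|h]; first exact: (h (0, i)).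
by split=> // -[a i] _ /=; rewrite (ord1 a).
Qed.

Lemma rV_norm_coord (R : realType) (n : nat) (v : 'rV[R]_n) i : `|v 0 i| <= `|v|.
Proof. by have /rV_normP : `|v| <= `|v| by []; apply. Qed.

(** Row sums bound the operator norm of [1 - B] for the sup norm, so a column vector [v] killed by
    [B] satisfies [|v| <= q * |v|] and vanishes. *)
Lemma near_identity_unitmx (R : realType) (n : nat) (B : 'M[R]_n) (q : R) :
  0 <= q < 1 -> (forall i, \sum_l `|(i == l)%:R - B i l| <= q) -> B \in unitmx.
Proof.
move=> /andP[q0 q1] hB; rewrite -unitmx_tr unitmxE unitfE; apply/det0P => -[v v0 vB].
have: `|v| <= q * `|v|.
  apply/rV_normP; first by rewrite mulr_ge0.
  move=> i; have -> : v 0 i = \sum_l ((i == l)%:R - B i l) * v 0 l.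
    under eq_bigr => l _ do rewrite mulrBl.
    rewrite sumrB (bigD1 i) //= eqxx mul1r big1 ?addr0; last first.
      by move=> l; rewrite eq_sym => /negPf ->; rewrite mul0r.
    have -> : \sum_l B i l * v 0 l = 0.
      have /rowP/(_ i) := vB; rewrite !mxE => {2}<-; apply: eq_bigr => l _.
      by rewrite mxE mulrC.
    by rewrite subr0.
  apply: (le_trans (ler_norm_sum _ _ _)).
  apply: (@le_trans _ _ (\sum_l `|(i == l)%:R - B i l| * `|v|)).
    by apply: ler_sum => l _; rewrite normrM ler_wpM2l // rV_norm_coord.
  by rewrite -mulr_suml ler_wpM2r.
rewrite -subr_ge0 -{2}[`|v|]mul1r -mulrBl leNgt => /negP; apply.
by rewrite nmulr_rlt0 ?subr_lt0 // normr_gt0.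
Qed.

(** Midpoints of points of the cube stay in the cube, so the Jacobian bound makes the Newton map
    [q]-Lipschitz there. The residual bound lets the centre move by at most [(1 - q) * rho], so the
    cube is mapped into itself and Banach's theorem applies. *)
Lemma newton_kantorovich (R : realType) (n : nat)
    (F : 'rV[R]_n -> 'cV[R]_n) (DF : 'rV[R]_n -> 'M[R]_n)
    (A : 'M[R]_n) (x0 : 'rV[R]_n) (rho q : R) :
  0 <= q < 1 -> 0 <= rho ->
  (forall x y : 'rV[R]_n, F x - F y = DF (2^-1 *: (x + y)) *m (x - y)^T) ->
  (forall m : 'rV[R]_n, (forall k, `|m 0 k - x0 0 k| <= rho) ->
     forall i, \sum_l `|(i == l)%:R - (A *m DF m) i l| <= q) ->
  (forall i, `|(A *m F x0) i 0| <= (1 - q) * rho) ->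
  exists2 x : 'rV[R]_n, (forall k, `|x 0 k - x0 0 k| <= rho) & F x = 0.
Proof.
move=> q01 rho0 FD hD hF; have /andP[q0 q1] := q01.
pose U : set 'rV[R]_n := [set x | `|x - x0| <= rho]%classic.
have UP x : U x <-> forall k, `|x 0 k - x0 0 k| <= rho.
  split=> [/(rV_normP _ rho0) h k|h]; first by have := h k; rewrite !mxE.
  by apply/rV_normP => // k; rewrite !mxE.
pose T (x : 'rV[R]_n) := x - (A *m F x)^T.
have TL x y : U x -> U y -> `|T x - T y| <= q * `|x - y|.
  move=> Ux Uy; apply/rV_normP => [|i]; first by rewrite mulr_ge0.
  set m := 2^-1 *: (x + y).
  have mU k : `|m 0 k - x0 0 k| <= rho.
    have := (UP x).1 Ux k; have := (UP y).1 Uy k; rewrite !mxE.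
    by rewrite !ler_norml => /andP[a b] /andP[c d]; apply/andP; split; lra.
  have -> : (T x - T y) 0 i = \sum_l ((i == l)%:R - (A *m DF m) i l) * (x - y) 0 l.
    have -> : T x - T y = x - y - (A *m (F x - F y))^T.
      by apply/rowP => k; rewrite mulmxBr !mxE; ring.
    rewrite FD -/m mulmxA; under eq_bigr => l _ do rewrite mulrBl.
    rewrite sumrB (bigD1 i) //= eqxx mul1r big1 ?addr0; last first.
      by move=> l; rewrite eq_sym => /negPf ->; rewrite mul0r.
    rewrite mxE; congr (_ + _); rewrite !mxE; congr (- _).
    by apply: eq_bigr => l _; rewrite !mxE.
  apply: (le_trans (ler_norm_sum _ _ _)).
  apply: (@le_trans _ _ (\sum_l `|(i == l)%:R - (A *m DF m) i l| * `|x - y|)).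
    by apply: ler_sum => l _; rewrite normrM ler_wpM2l // rV_norm_coord.
  by rewrite -mulr_suml ler_wpM2r // hD.
have Ux0 : U x0 by rewrite /U /= subrr normr0.
have TU : {homo T : x / U x >-> U x}.
  move=> x Ux; rewrite /U /=.
  have -> : T x - x0 = (T x - T x0) + (T x0 - x0) by rewrite addrA subrK.
  apply: (le_trans (ler_normD _ _)).
  have -> : rho = q * rho + (1 - q) * rho by ring.
  apply: lerD.
    by apply: (le_trans (TL _ _ Ux Ux0)); apply: ler_wpM2l.
  apply/rV_normP => [|i]; first by rewrite mulr_ge0 // subr_ge0 ltW.
  by have := hF i; rewrite /T addrAC subrr add0r !mxE normrN.
have [x Ux xT] : exists2 x, U x & x = T x.
  apply: (@banach_fixed_point _ _ U (mkfun_fun TU)).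
  - exists (NngNum q0); split=> //= -[x y] [] /= Ux Uy.
    exact: TL.
  - rewrite (_ : U = closed_ball_ Num.norm x0 rho)%classic; last first.
      by rewrite /U /closed_ball_; apply/seteqP; split=> x /=; rewrite distrC.
    exact: closed_closed_ball_.
  - by exists x0.
exists x; first exact/UP.
have AF0 : A *m F x = 0.
  apply: trmx_inj; rewrite trmx0.
  have : x - T x = 0 by rewrite -xT subrr.
  by rewrite /T opprB addrC subrK.
(* To pass from [A *m F x = 0] to [F x = 0], [A] must be invertible; this comes from [A *m DF x0]
   being close to the identity. *)
have : A *m DF x0 \in unitmx.
  apply: (near_identity_unitmx q01) => i; apply: hD => k.
  by rewrite subrr normr0.
rewrite unitmx_mul => /andP[Au _].
by rewrite -[F x]mul1mx -(mulVmx Au) -mulmxA AF0 mulmx0.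
Qed.

(** * Integer certificates for roots of quadratic systems *)

(* A sum of monomials [c * X_j * X_k], encoded as triples [(c, j, k)]. With
   unknowns numbered below [n], every index from [n] on denotes the constant 1
   (or, after clearing denominators, the common denominator). *)
Definition quadpoly := seq (Z * nat * nat).

(* The evaluators are generic so that they run on [Z] and are reasoned about in
   [R]. *)
Section Evaluation.
Variables (T : realDomainType) (c : Z -> T).

Definition isum (n : nat) (f : nat -> T) : T := foldr (fun i s => f i + s) 0 (iota 0 n).

Definition qeval (e : nat -> T) (p : quadpoly) : T :=
  foldr (fun t s => c t.1.1 * e t.1.2 * e t.2 + s) 0 p.

Definition qgrad (e : nat -> T) (p : quadpoly) (l : nat) : T :=
  foldr (fun t s => c t.1.1 * ((if t.1.2 == l then e t.2 else 0) +
                               (if t.2 == l then e t.1.2 else 0)) + s) 0 p.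

(** The absolute second derivatives involving [X_l], summed monomial by monomial: a Lipschitz
    constant for the [l]-th partial derivative in the sup norm. A constant cofactor contributes
    nothing. *)
Definition qcurv (n : nat) (p : quadpoly) (l : nat) : T :=
  foldr (fun t s => `|c t.1.1| * ((if (t.1.2 == l) && (t.2 < n)%N then 1 else 0) +
                                  (if (t.2 == l) && (t.1.2 < n)%N then 1 else 0)) + s) 0 p.

Lemma isumE n f : isum n f = \sum_(i < n) f i.
Proof.
rewrite -(big_mkord xpredT f) /isum /index_iota subn0.
by elim: (iota 0 n) => [|i s ih]; rewrite ?big_nil // big_cons /= ih.
Qed.

End Evaluation.

Section Embedding.
Variable R : realType.

Definition zr (z : Z) : R := (int_of_Z z)%:~R.

Lemma zrD a b : zr (a + b) = zr a + zr b. Proof. by rewrite /zr !rmorphD. Qed.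
Lemma zrM a b : zr (a * b) = zr a * zr b. Proof. by rewrite /zr !rmorphM. Qed.
Lemma zrB a b : zr (a - b) = zr a - zr b. Proof. by rewrite /zr !rmorphB. Qed.
Lemma zr0 : zr 0 = 0. Proof. by rewrite /zr !rmorph0. Qed.
Lemma zr1 : zr 1 = 1. Proof. by rewrite /zr !rmorph1. Qed.
Lemma zr2 : zr 2 = 2. Proof. by []. Qed.
Lemma zr_le a b : (zr a <= zr b) = (a <= b). Proof. by rewrite /zr ler_int; lia. Qed.
Lemma zr_lt a b : (zr a < zr b) = (a < b). Proof. by rewrite /zr ltr_int; lia. Qed.
Lemma zr_norm a : zr `|a| = `|zr a|.
Proof. by rewrite /zr -intr_norm; congr (_%:~R); lia. Qed.

Definition zrE := (zrD, zrM, zrB, zr0, zr1, zr2, zr_norm).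

Lemma zr_isum n f : zr (isum n f) = isum n (fun i => zr (f i)).
Proof. by rewrite /isum; elim: (iota 0 n) => [|i s ih] /=; rewrite zrE // ih. Qed.

Lemma zr_qeval e p : zr (qeval id e p) = qeval zr (zr \o e) p.
Proof. by rewrite /qeval; elim: p => [|t p ih] /=; rewrite !zrE // ih. Qed.

Lemma zr_qgrad e p l : zr (qgrad id e p l) = qgrad zr (zr \o e) p l.
Proof.
rewrite /qgrad; elim: p => [|t p ih] /=; rewrite !zrE // ih.
by case: ifP; case: ifP; rewrite ?zrE.
Qed.

Lemma zr_qcurv n p l : zr (qcurv id n p l) = qcurv zr n p l.
Proof.
rewrite /qcurv; elim: p => [|t p ih] /=; rewrite !zrE // ih.
by case: ifP; case: ifP; rewrite ?zrE.
Qed.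

(** With the constant stored as an extra coordinate, every term is homogeneous of degree 2; clearing
    denominators is then a mere rescaling. *)
Lemma qevalZ (a : R) e p : qeval zr (fun k => e k * a) p = qeval zr e p * a ^+ 2.
Proof. by rewrite /qeval; elim: p => [|t p ih] /=; rewrite ?mul0r // ih; ring. Qed.

Lemma qgradZ (a : R) e p l : qgrad zr (fun k => e k * a) p l = qgrad zr e p l * a.
Proof.
rewrite /qgrad; elim: p => [|t p ih] /=; rewrite ?mul0r // ih.
by case: ifP; case: ifP => _ _; ring.
Qed.

Definition dehom n (x : 'rV[R]_n) (k : nat) : R := if insub k is Some i then x 0 i else 1.

Lemma dehom_ord n (x : 'rV[R]_n) (i : 'I_n) : dehom x i = x 0 i.
Proof. by rewrite /dehom valK. Qed.

Lemma dehom_out n (x : 'rV[R]_n) k : (n <= k)%N -> dehom x k = 1.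
Proof. by rewrite /dehom => h; rewrite insubF // ltnNge h. Qed.

Lemma sum_delta n (x y : 'rV[R]_n) (a : R) (j : nat) :
  \sum_(l < n) (if j == l then a else 0) * (x 0 l - y 0 l) = a * (dehom x j - dehom y j).
Proof.
case: (ltnP j n) => hj; last first.
  rewrite !dehom_out // subrr mulr0 big1 // => l _.
  by rewrite ifN ?mul0r //; have := ltn_ord l; lia.
rewrite (bigD1 (Ordinal hj)) //= eqxx big1 ?addr0 => [|l hl].
  by rewrite -!(dehom_ord _ (Ordinal hj)).
by rewrite ifN ?mul0r //; apply: contraNneq hl => h; apply/eqP/val_inj; rewrite /= h.
Qed.

(** Per monomial, [u v - u' v'] is the mean of [v] times [u - u'] plus the mean of [u] times
    [v - v'], without remainder. *)
Lemma qeval_sub n (x y : 'rV[R]_n) p :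
  qeval zr (dehom x) p - qeval zr (dehom y) p =
  \sum_(l < n) qgrad zr (dehom (2^-1 *: (x + y))) p l * (x 0 l - y 0 l).
Proof.
set m := 2^-1 *: _.
have hm k : dehom m k = (dehom x k + dehom y k) / 2.
  by rewrite /dehom; case: insubP => [i _ _|_]; rewrite ?mxE; field.
rewrite /qeval /qgrad; elim: p => [|t p ih] /=.
  by rewrite subrr big1 // => l _; rewrite mul0r.
have -> (a b d e : R) : a + b - (d + e) = a - d + (b - e) by ring.
rewrite ih.
have -> : zr t.1.1 * dehom x t.1.2 * dehom x t.2 - zr t.1.1 * dehom y t.1.2 * dehom y t.2 =
   zr t.1.1 * (dehom m t.2 * (dehom x t.1.2 - dehom y t.1.2) +
               dehom m t.1.2 * (dehom x t.2 - dehom y t.2)) by rewrite !hm; field.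
rewrite -!sum_delta -big_split mulr_sumr -big_split /=.
by apply: eq_bigr => l _; rewrite [RHS]mulrDl; congr (_ + _); rewrite -mulrA mulrDl.
Qed.

Lemma qgrad_near n (x y : 'rV[R]_n) (rho : R) p l :
  0 <= rho -> (forall k, `|x 0 k - y 0 k| <= rho) ->
  `|qgrad zr (dehom x) p l - qgrad zr (dehom y) p l| <= rho * qcurv zr n p l.
Proof.
move=> rho0 h.
have hk k : `|dehom x k - dehom y k| <= rho * (if (k < n)%N then 1 else 0).
  case: ltnP => hk; first by rewrite mulr1 -[k]/(val (Ordinal hk)) !dehom_ord.
  by rewrite !dehom_out // subrr normr0 mulr0.
have hd j k : `|(if j == l then dehom x k else 0) - (if j == l then dehom y k else 0)| <=
    rho * (if (j == l) && (k < n)%N then 1 else 0).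
  by case: eqP => _ //=; rewrite subrr normr0 mulr0.
rewrite /qgrad /qcurv; elim: p => [|t p ih] /=; first by rewrite subrr normr0 mulr0.
have -> (a b d e f g u : R) : a * (b + d) + e - (a * (f + g) + u) =
   a * ((b - f) + (d - g)) + (e - u) by ring.
apply: (le_trans (ler_normD _ _)); rewrite [leRHS]mulrDr; apply: lerD => //.
rewrite normrM mulrCA ler_wpM2l //.
apply: (le_trans (ler_normD _ _)); rewrite [leRHS]mulrDr; exact: lerD.
Qed.

End Embedding.

(* [X / D] approximates a root, [A / E] the inverse Jacobian there, [P / D] is the
   radius of the cube, and the contraction constant is 1/2. *)
Section Certificate.
Variables (n : nat) (S : seq quadpoly) (X : seq Z) (A : seq (seq Z)) (D E P : Z).

Let s r := nth [::] S r.
Let a i r := nth 0 (nth [::] A i) r.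
(** The default [D] is the constant 1 over the common denominator [D]. *)
Let x k := nth D X k.

(** Multiplied by [2 * E * D]: each row sum of [1 - A DF] at the centre, plus a bound on its
    variation over the cube, is at most 1/2. *)
Definition contraction_ok : bool :=
  all (fun i => 2 * isum n (fun l =>
      `|(if i == l then E * D else 0) - isum n (fun r => a i r * qgrad id x (s r) l)| +
       P * isum n (fun r => `|a i r| * qcurv id n (s r) l)) <= E * D) (iota 0 n).

(** The residual has denominator [E * D ^ 2] and must not exceed half the radius [P / D]. *)
Definition residual_ok : bool :=
  all (fun i => 2 * `|isum n (fun r => a i r * qeval id x (s r))| <= P * (E * D)) (iota 0 n).

Variable R : realType.
Local Notation z := (@zr R).

Lemma quadratic_system_solvable :
  size X = n -> 0 < D -> 0 < E -> 0 <= P -> contraction_ok -> residual_ok ->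
  exists e : nat -> R,
    [/\ forall k, (n <= k)%N -> e k = 1,
        forall k, (k < n)%N -> `|e k - z (x k) / z D| <= z P / z D
      & forall r, (r < n)%N -> qeval z e (s r) = 0].
Proof.
move=> sX D0 E0 P0 /allP hC /allP hR.
have dD : 0 < z D by rewrite -(zr0 R) zr_lt.
have dE : 0 < z E by rewrite -(zr0 R) zr_lt.
have dP : 0 <= z P by rewrite -(zr0 R) zr_le.
pose x0 : 'rV[R]_n := \row_k (z (x k) / z D).
have x0E k : dehom x0 k = (z \o x) k * (z D)^-1.
  case: (ltnP k n) => hk; first by rewrite -[k]/(val (Ordinal hk)) dehom_ord mxE.
  by rewrite dehom_out //= /x nth_default ?sX // divff // gt_eqF.
pose F (u : 'rV[R]_n) : 'cV[R]_n := \col_r qeval z (dehom u) (s r).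
pose DF (u : 'rV[R]_n) : 'M[R]_n := \matrix_(r, l) qgrad z (dehom u) (s r) l.
pose M : 'M[R]_n := \matrix_(i, r) (z (a i r) / z E).
have qe p : qeval z (dehom x0) p = z (qeval id x p) / z D ^+ 2.
  by rewrite (funext x0E) qevalZ exprVn zr_qeval.
have qg p l : qgrad z (dehom x0) p l = z (qgrad id x p l) / z D.
  by rewrite (funext x0E) qgradZ zr_qgrad.
have [||u v|m hm i|i|u hu Fu] :=
  @newton_kantorovich R n F DF M x0 (z P / z D) (2^-1).
- by apply/andP; split; lra.
- by rewrite divr_ge0 // ltW.
- apply/colP => r; rewrite !mxE (qeval_sub u v).
  by apply: eq_bigr => l _; rewrite !mxE.
- have /hC : val i \in iota 0 n by rewrite mem_iota /= ltn_ord.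
  rewrite -(zr_le R) !zrE zr_isum isumE => h.
  apply: (@le_trans _ _ ((\sum_(l < n) z (`|(if val i == l then E * D else 0) -
        isum n (fun r => a i r * qgrad id x (s r) l)| +
        P * isum n (fun r => `|a i r| * qcurv id n (s r) l))) / (z E * z D))); last first.
    by rewrite ler_pdivrMr ?mulr_gt0 //; lra.
  rewrite mulr_suml; apply: ler_sum => l _.
  rewrite [z _]zrE zr_norm [z (P * _)]zrM [z (_ - _)]zrB !zr_isum !isumE.
  rewrite mulrDl.
  (* Splitting at the centre matches the two summands of the integer test: the defect there and the
     variation controlled by [qcurv]. *)
  have -> : (i == l)%:R - (M *m DF m) i l =
     ((i == l)%:R - (M *m DF x0) i l) - (M *m (DF m - DF x0)) i l.
    by rewrite mulmxBr !mxE; ring.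
  apply: (le_trans (ler_normB _ _)); apply: lerD.
    rewrite -[z E * z D]gtr0_norm ?mulr_gt0 // -normf_div.
    rewrite le_eqVlt; apply/orP; left; apply/eqP; congr `|_|; rewrite mulrBl; congr (_ - _).
      rewrite -val_eqE; case: eqP => _; last by rewrite zr0 mul0r.
      by rewrite zrM divff // mulf_neq0 // gt_eqF.
    rewrite mxE mulr_suml; apply: eq_bigr => r _; rewrite !mxE qg [z (_ * _)]zrM.
    by field; rewrite !gt_eqF.
  rewrite mxE; apply: (le_trans (ler_norm_sum _ _ _)).
  rewrite mulr_sumr mulr_suml; apply: ler_sum => r _.
  rewrite !mxE normrM [z (_ * _)]zrM zr_norm zr_qcurv.
  have := @qgrad_near R n m x0 (z P / z D) (s r) l.
  rewrite divr_ge0 ?(ltW dD) // => /(_ isT hm) /(ler_wpM2l (normr_ge0 (z (a i r) / z E))) h1.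
  apply: (le_trans h1); rewrite normf_div (gtr0_norm dE).
  rewrite le_eqVlt; apply/orP; left; apply/eqP.
  by field; rewrite !gt_eqF.
- have /hR : val i \in iota 0 n by rewrite mem_iota /= ltn_ord.
  rewrite -(zr_le R) !zrE zr_isum isumE => h.
  have -> : (M *m F x0) i 0 = (\sum_(r < n) z (a i r * qeval id x (s r))) / (z E * z D ^+ 2).
    rewrite mxE mulr_suml; apply: eq_bigr => r _; rewrite !mxE qe [z (_ * _)]zrM.
    by field; rewrite !gt_eqF.
  have d2 : 0 < z E * z D ^+ 2 by rewrite mulr_gt0 ?exprn_gt0.
  rewrite normf_div (gtr0_norm d2) ler_pdivrMr //.
  have -> : (1 - 2^-1) * (z P / z D) * (z E * z D ^+ 2) = 2^-1 * (z P * (z E * z D)).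
    by field; rewrite gt_eqF.
  by lra.
exists (dehom u); split=> [k|k hk|r hr]; first exact: dehom_out.
  by have := hu (Ordinal hk); rewrite -dehom_ord mxE.
by have /colP/(_ (Ordinal hr)) := Fu; rewrite !mxE.
Qed.

End Certificate.

(** * The quadratic system of the simplex and its certified root *)

Section Certificates.
Local Open Scope Z_scope.

(* Unknowns: 0, 1 are the first two diagonal entries, 2, 3 the real parts of the
   first two off-diagonal entries, 4 to 17 the coefficients placed by [simplex_x],
   [simplex_y], [simplex_z] below; index 18 stands for the constant 1. Equations
   0 to 9 say that the matrix has rank one, the others prescribe its weights. *)
Definition simplex_system : seq quadpoly := [::
  [:: (-1, 0%N, 2%N); (-1, 1%N, 2%N); (1, 2%N, 3%N); (1, 2%N, 18%N);
     (1, 3%N, 3%N); (-1, 4%N, 4%N); (-1, 5%N, 5%N); (1, 6%N, 6%N);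
     (1, 7%N, 7%N); (1, 8%N, 8%N); (1, 10%N, 11%N); (1, 13%N, 14%N);
     (1, 16%N, 17%N)];
  [:: (-1, 0%N, 8%N); (-1, 1%N, 8%N); (-1, 2%N, 4%N); (-1, 2%N, 8%N);
     (-2, 3%N, 4%N); (1, 5%N, 13%N); (1, 5%N, 14%N); (1, 6%N, 10%N);
     (-1, 6%N, 11%N); (1, 7%N, 16%N); (-1, 7%N, 17%N); (1, 8%N, 18%N)];
  [:: (-1, 0%N, 9%N); (-1, 1%N, 9%N); (-1, 2%N, 10%N); (-1, 3%N, 10%N);
     (1, 3%N, 11%N); (-2, 4%N, 6%N); (2, 5%N, 7%N); (1, 9%N, 18%N);
     (1, 13%N, 17%N); (-1, 14%N, 16%N)];
  [:: (2, 0%N, 6%N); (2, 1%N, 6%N); (-1, 2%N, 6%N); (1, 4%N, 10%N);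
     (1, 4%N, 11%N); (1, 5%N, 16%N); (1, 5%N, 17%N); (-2, 6%N, 18%N);
     (-1, 7%N, 13%N); (1, 7%N, 14%N); (-1, 8%N, 10%N); (1, 8%N, 11%N)];
  [:: (-1, 2%N, 5%N); (-2, 3%N, 5%N); (-1, 4%N, 13%N); (-1, 4%N, 14%N);
     (1, 6%N, 16%N); (-1, 6%N, 17%N); (-1, 7%N, 10%N); (1, 7%N, 11%N);
     (1, 8%N, 13%N); (-1, 8%N, 14%N)];
  [:: (-1, 0%N, 12%N); (-1, 1%N, 12%N); (-1, 2%N, 13%N); (-1, 3%N, 13%N);
     (1, 3%N, 14%N); (-2, 5%N, 8%N); (-1, 10%N, 17%N); (1, 11%N, 16%N);
     (1, 12%N, 18%N)];
  [:: (2, 0%N, 7%N); (2, 1%N, 7%N); (-1, 2%N, 7%N); (1, 4%N, 16%N);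
     (1, 4%N, 17%N); (-1, 5%N, 10%N); (-1, 5%N, 11%N); (1, 6%N, 13%N);
     (-1, 6%N, 14%N); (-2, 7%N, 18%N); (-1, 8%N, 16%N); (1, 8%N, 17%N)];
  [:: (-1, 0%N, 15%N); (-1, 1%N, 15%N); (-1, 2%N, 16%N); (-1, 3%N, 16%N);
     (1, 3%N, 17%N); (-2, 4%N, 7%N); (-2, 5%N, 6%N); (1, 10%N, 14%N);
     (-1, 11%N, 13%N); (1, 15%N, 18%N)];
  [:: (-1, 0%N, 0%N); (-1, 0%N, 1%N); (1, 0%N, 18%N); (-1, 2%N, 2%N);
     (-2, 2%N, 3%N); (-1, 3%N, 3%N); (-1, 4%N, 4%N); (2, 4%N, 8%N);
     (-1, 5%N, 5%N); (-1, 6%N, 6%N); (-1, 7%N, 7%N); (-1, 8%N, 8%N);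
     (-1, 11%N, 11%N); (-1, 14%N, 14%N); (-1, 17%N, 17%N)];
  [:: (-1, 0%N, 1%N); (-1, 1%N, 1%N); (1, 1%N, 18%N); (-1, 3%N, 3%N);
     (-1, 4%N, 4%N); (-2, 4%N, 8%N); (-1, 5%N, 5%N); (-1, 6%N, 6%N);
     (-1, 7%N, 7%N); (-1, 8%N, 8%N); (-1, 10%N, 10%N); (-1, 13%N, 13%N);
     (-1, 16%N, 16%N)];
  [:: (207, 8%N, 8%N); (-4, 18%N, 18%N)];
  [:: (46, 4%N, 4%N); (46, 5%N, 5%N); (138, 6%N, 6%N); (138, 7%N, 7%N);
     (69, 8%N, 8%N); (-4, 18%N, 18%N)];
  [:: (23, 9%N, 9%N); (23, 10%N, 10%N); (23, 11%N, 11%N); (-1, 18%N, 18%N)];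
  [:: (1, 9%N, 10%N); (1, 9%N, 11%N); (1, 10%N, 11%N)];
  [:: (23, 12%N, 12%N); (23, 13%N, 13%N); (23, 14%N, 14%N); (-1, 18%N, 18%N)];
  [:: (1, 12%N, 13%N); (1, 12%N, 14%N); (1, 13%N, 14%N)];
  [:: (23, 15%N, 15%N); (23, 16%N, 16%N); (23, 17%N, 17%N); (-1, 18%N, 18%N)];
  [:: (1, 15%N, 16%N); (1, 15%N, 17%N); (1, 16%N, 17%N)]].

(* The root, in units of 10^-4. *)
Definition approx_root : seq Z :=
  [:: 2581; 2151; -30; 166; -800; 1766; 153; 809; -1390; 152; -165; -2073;
     -679; 1564; 1201; -648; 485; -1922].

(* The inverse of the Jacobian at the root, in units of 10^-3. *)
Definition approx_inverse : seq (seq Z) := [::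
  [:: -2251; 6445; 2755; 527; 828; 1668; -2522; 725; -440; -2338; 128; -233;
     17; 6538; -116; -4488; 31; 2022];
  [:: 1121; -2565; -2315; -106; -821; -1774; 3684; 424; 4227; 6126; -76; 294;
     94; -5156; 178; 5395; 78; -66];
  [:: 4632; -3950; -2009; 191; 53; 3080; 1924; -1283; 1141; 1141; -128; 158;
     42; -4598; 92; -4831; 45; -5647];
  [:: -6046; 8087; 1972; -201; -576; -7095; -3067; 1789; -3873; -3873; 221;
     -293; -177; 4087; -348; 9585; -197; 10650];
  [:: 938; -308; 1596; 69; -638; 4617; -986; -981; -527; -527; -10; -81; 29;
     3849; 102; -7649; 56; -4752];
  [:: 1505; -1645; 249; 233; -279; 3381; 573; -1047; -631; -631; -61; 26; -11;
     552; 71; -5639; 3; -3895];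
  [:: -242; 383; -516; -816; 468; -890; 50; 1; 319; 319; 11; 15; 30; -1119;
     -23; 1438; -21; 438];
  [:: -740; 1023; 443; 7; -96; -769; -751; 438; 225; 225; 24; -4; 12; 1079;
     -14; 1308; 20; 1184];
  [:: 0; 0; 0; 0; 0; 0; 0; 0; 0; 0; -17; 0; 0; 0; 0; 0; 0; 0];
  [:: -1473; 1330; 1909; -50; -655; -2417; -19; 618; -424; -424; 47; -51; -41;
     -103; -34; 4217; -12; 2521];
  [:: 1717; -1551; -2227; 58; 764; 2818; 22; -721; 494; 494; -55; 59; 49;
     -5089; 40; -4918; 14; -2939];
  [:: -245; 221; 317; -8; -109; -401; -3; 103; -70; -70; 8; -8; -112; 396; -6;
     700; -2; 419];
  [:: 567; -1200; -480; -116; -339; 156; 697; -73; 798; 798; -29; 58; 24;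
     -1054; 14; 3473; 23; -742];
  [:: 2934; -6211; -2482; -598; -1752; 808; 3606; -379; 4131; 4131; -151; 301;
     123; -5457; 324; 2124; 118; -3843];
  [:: -3501; 7411; 2962; 714; 2091; -964; -4303; 452; -4929; -4929; 180; -359;
     -147; 6511; -233; -801; -141; 4586];
  [:: -3491; 5711; 2360; -399; 421; -2805; -2938; 2322; -4102; -4102; 156;
     -285; -163; 5045; -280; 2181; -154; 4739];
  [:: 1848; -3023; -1249; 211; -223; 1485; 1555; -1229; 2171; 2171; -82; 151;
     86; -2670; 148; -1154; 88; -6338];
  [:: 1643; -2688; -1111; 188; -198; 1321; 1383; -1093; 1931; 1931; -73; 134;
     77; -2375; 132; -1027; -39; -3197]].

Lemma simplex_contraction_ok :
  contraction_ok 18 simplex_system approx_root approx_inverse 10000 1000 2.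
Proof. by vm_compute. Qed.

Lemma simplex_residual_ok :
  residual_ok 18 simplex_system approx_root approx_inverse 10000 1000 2.
Proof. by vm_compute. Qed.

End Certificates.

Lemma simplex_system_solvable (R : realType) : exists e : nat -> R,
  [/\ e 18%N = 1, 0 < 1 - e 0%N - e 1%N
    & forall r, (r < 18)%N -> qeval (@zr R) e (nth [::] simplex_system r) = 0].
Proof.
have [||||e [e1 eX eS]] := @quadratic_system_solvable 18 _ _ _ _ _ _ R _ _ _ _
  simplex_contraction_ok simplex_residual_ok => //.
exists e; split; [exact: e1| |exact: eS].
have dD : 0 < zr R (Zpos 10000) by rewrite -(zr0 R) zr_lt.
(* The approximate first two diagonal entries, each enlarged by the radius 2, still sum to less than
   1. *)
have : zr R (Zpos 2151 + Zpos 2581 + 2 + 2) < zr R (Zpos 10000) by rewrite zr_lt.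
have := eX 0%N isT; have := eX 1%N isT.
rewrite !ler_norml ![nth _ _ _]/= => /andP[_ h1] /andP[_ h0].
move: h1 h0; rewrite !lerBlDr -!mulrDl !ler_pdivlMr // !zrE => h1 h0 h.
by rewrite -(pmulr_lgt0 _ dD); lra.
Qed.

(** * Octonions and projections *)

Section OctonionCoordinates.
Variable R : realType.
Implicit Types (x : oct R) (a : R).

Lemma pairD (U V : zmodType) (u u' : U) (v v' : V) : (u, v) + (u', v') = (u + u', v + v').
Proof. by []. Qed.

Lemma pairN (U V : zmodType) (u : U) (v : V) : - (u, v) = (- u, - v).
Proof. by []. Qed.

Definition oreal a : oct R := (((a, 0), (0, 0)), ((0, 0), (0, 0))).
Definition onorm x : R := ore (omul x (oconj x)).

(** The multiplication table in real coordinates, which turns octonion identities into polynomial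
    ones for [ring]. *)
Lemma omulE (x0 x1 x2 x3 x4 x5 x6 x7 y0 y1 y2 y3 y4 y5 y6 y7 : R) :
  omul (((x0, x1), (x2, x3)), ((x4, x5), (x6, x7))) (((y0, y1), (y2, y3)), ((y4, y5), (y6, y7))) =
  (((x0 * y0 - x1 * y1 - x2 * y2 - x3 * y3 - x4 * y4 - x5 * y5 - x6 * y6 - x7 * y7,
     x0 * y1 + x1 * y0 + x2 * y3 - x3 * y2 + x4 * y5 - x5 * y4 - x6 * y7 + x7 * y6),
    (x0 * y2 - x1 * y3 + x2 * y0 + x3 * y1 + x4 * y6 + x5 * y7 - x6 * y4 - x7 * y5,
     x0 * y3 + x1 * y2 - x2 * y1 + x3 * y0 + x4 * y7 - x5 * y6 + x6 * y5 - x7 * y4)),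
   ((x0 * y4 - x1 * y5 - x2 * y6 - x3 * y7 + x4 * y0 + x5 * y1 + x6 * y2 + x7 * y3,
     x0 * y5 + x1 * y4 - x2 * y7 + x3 * y6 - x4 * y1 + x5 * y0 - x6 * y3 + x7 * y2),
    (x0 * y6 + x1 * y7 + x2 * y4 - x3 * y5 - x4 * y2 + x5 * y3 + x6 * y0 - x7 * y1,
     x0 * y7 - x1 * y6 + x2 * y5 + x3 * y4 - x4 * y3 - x5 * y2 + x6 * y1 + x7 * y0))).
Proof.
rewrite /omul /qmul /qconj /cmul /cconj /= !(pairD, pairN) /=.
by repeat match goal with |- (_, _) = (_, _) => apply: f_equal2 end; ring.
Qed.

Lemma oconjE (x0 x1 x2 x3 x4 x5 x6 x7 : R) :
  oconj (((x0, x1), (x2, x3)), ((x4, x5), (x6, x7))) =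
  (((x0, - x1), (- x2, - x3)), ((- x4, - x5), (- x6, - x7))).
Proof. by []. Qed.

End OctonionCoordinates.

Ltac octring := rewrite /onorm /oreal /oone ?(omulE, oconjE, pairD, pairN) /ore /=;
  repeat match goal with |- (_, _) = (_, _) => apply: f_equal2 end; ring.

Section OctonionAlgebra.
Variable R : realType.
Implicit Types (x y z : oct R) (a b : R).

Lemma oconjD x y : oconj (x + y) = oconj x + oconj y.
Proof.
move: x y => [[[x0 x1] [x2 x3]] [[x4 x5] [x6 x7]]] [[[y0 y1] [y2 y3]] [[y4 y5] [y6 y7]]].
octring.
Qed.

Lemma oconjM x y : oconj (omul x y) = omul (oconj y) (oconj x).
Proof.
move: x y => [[[x0 x1] [x2 x3]] [[x4 x5] [x6 x7]]] [[[y0 y1] [y2 y3]] [[y4 y5] [y6 y7]]].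
octring.
Qed.

Lemma oconjK x : oconj (oconj x) = x.
Proof. by move: x => [[[x0 x1] [x2 x3]] [[x4 x5] [x6 x7]]]; octring. Qed.

Lemma oconj_real a : oconj (oreal a) = oreal a.
Proof. octring. Qed.

Lemma orealD a b : oreal a + oreal b = oreal (a + b).
Proof. octring. Qed.

Lemma omul_real a b : omul (oreal a) (oreal b) = oreal (a * b).
Proof. octring. Qed.

Lemma omulC_real a x : omul x (oreal a) = omul (oreal a) x.
Proof. by move: x => [[[x0 x1] [x2 x3]] [[x4 x5] [x6 x7]]]; octring. Qed.

Lemma omul_realDl a b x : omul (oreal a) x + omul (oreal b) x = omul (oreal (a + b)) x.
Proof. by move: x => [[[x0 x1] [x2 x3]] [[x4 x5] [x6 x7]]]; octring. Qed.

Lemma omul_realA a b x : omul (oreal a) (omul (oreal b) x) = omul (oreal (a * b)) x.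
Proof. by move: x => [[[x0 x1] [x2 x3]] [[x4 x5] [x6 x7]]]; octring. Qed.

Lemma omul1 x : omul (oreal 1) x = x.
Proof. by move: x => [[[x0 x1] [x2 x3]] [[x4 x5] [x6 x7]]]; octring. Qed.

Lemma omul_real_inj a x y : a != 0 -> omul (oreal a) x = omul (oreal a) y -> x = y.
Proof.
by move=> a0 h; rewrite -[x]omul1 -[y]omul1 -(mulVf a0) -!omul_realA h.
Qed.

Lemma omul_realAl a x y : omul (omul (oreal a) x) y = omul (oreal a) (omul x y).
Proof.
move: x y => [[[x0 x1] [x2 x3]] [[x4 x5] [x6 x7]]] [[[y0 y1] [y2 y3]] [[y4 y5] [y6 y7]]].
octring.
Qed.

Lemma omul_realAr a x y : omul x (omul (oreal a) y) = omul (oreal a) (omul x y).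
Proof.
move: x y => [[[x0 x1] [x2 x3]] [[x4 x5] [x6 x7]]] [[[y0 y1] [y2 y3]] [[y4 y5] [y6 y7]]].
octring.
Qed.

Lemma omul_conjr x : omul x (oconj x) = oreal (onorm x).
Proof. by move: x => [[[x0 x1] [x2 x3]] [[x4 x5] [x6 x7]]]; octring. Qed.

Lemma omul_conjl x : omul (oconj x) x = oreal (onorm x).
Proof. by move: x => [[[x0 x1] [x2 x3]] [[x4 x5] [x6 x7]]]; octring. Qed.

Lemma onorm_conj x : onorm (oconj x) = onorm x.
Proof. by move: x => [[[x0 x1] [x2 x3]] [[x4 x5] [x6 x7]]]; octring. Qed.

Lemma onorm_real a x : onorm (omul (oreal a) x) = a ^+ 2 * onorm x.
Proof. by move: x => [[[x0 x1] [x2 x3]] [[x4 x5] [x6 x7]]]; octring. Qed.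

Lemma onormM x y : onorm (omul x y) = onorm x * onorm y.
Proof.
move: x y => [[[x0 x1] [x2 x3]] [[x4 x5] [x6 x7]]] [[[y0 y1] [y2 y3]] [[y4 y5] [y6 y7]]].
octring.
Qed.

(** A form of alternativity, standing in for associativity when a factor is cancelled. *)
Lemma omulK_conjr x y : omul (omul x y) (oconj y) = omul (oreal (onorm y)) x.
Proof.
move: x y => [[[x0 x1] [x2 x3]] [[x4 x5] [x6 x7]]] [[[y0 y1] [y2 y3]] [[y4 y5] [y6 y7]]].
octring.
Qed.

Lemma omulK_conjl x y : omul (oconj x) (omul x y) = omul (oreal (onorm x)) y.
Proof.
move: x y => [[[x0 x1] [x2 x3]] [[x4 x5] [x6 x7]]] [[[y0 y1] [y2 y3]] [[y4 y5] [y6 y7]]].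
octring.
Qed.

Lemma ore_mulC x y : ore (omul x y) = ore (omul y x).
Proof.
move: x y => [[[x0 x1] [x2 x3]] [[x4 x5] [x6 x7]]] [[[y0 y1] [y2 y3]] [[y4 y5] [y6 y7]]].
octring.
Qed.

End OctonionAlgebra.

Section HermitianMatrices.
Variable R : realType.
Implicit Types (x y z : oct R) (a b d : R) (A B P : omx R).

(** Taking [z] at position (2,0) rather than (0,2) makes the cyclic shift rotate [x], [y], [z]. *)
Definition hmx d0 d1 d2 x y z : omx R :=
  \matrix_(i, j) match val i, val j with
  | 0, 0 => oreal d0 | 1, 1 => oreal d1 | 2, 2 => oreal d2
  | 0, 1 => x | 1, 0 => oconj x
  | 1, 2 => y | 2, 1 => oconj y
  | 2, 0 => z | _, _ => oconj z
  end%N.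

Lemma hmx_hermitian d0 d1 d2 x y z : ohermitian (hmx d0 d1 d2 x y z).
Proof.
move=> [[|[|[|i]]] hi] [[|[|[|j]]] hj] //;
  by rewrite !mxE /= ?oconjK ?oconj_real.
Qed.

Lemma ord3_1 : lift ord0 ord0 = 1 :> 'I_3. Proof. exact/val_inj. Qed.
Lemma ord3_2 : lift ord0 (lift ord0 ord0) = 2%:R :> 'I_3. Proof. exact/val_inj. Qed.

Lemma omxmulE A B i j : omxmul A B i j =
  omul (A i ord0) (B ord0 j) + omul (A i 1) (B 1 j) + omul (A i 2%:R) (B 2%:R j).
Proof.
by rewrite mxE 3!big_ord_recl big_ord0 addr0 addrA ord3_2 ord3_1.
Qed.

Lemma otrE A : otr A = A 0 0 + A 1 1 + A 2%:R 2%:R.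
Proof.
by rewrite /otr 3!big_ord_recl big_ord0 addr0 addrA ord3_2 ord3_1.
Qed.

Lemma hermitian_sqr_conj P i j : ohermitian P -> omxmul P P j i = oconj (omxmul P P i j).
Proof. by move=> hP; rewrite !omxmulE !oconjD !oconjM -!hP. Qed.

(* On the chart where the last diagonal entry is nonzero, a trace-one rank-one
   Hermitian matrix is determined by its last row: the other 2x2 minors then
   vanish because octonions are alternative and the norm is multiplicative. *)
Lemma hmx_OP2 d0 d1 d2 x y z : d2 != 0 -> d0 + d1 + d2 = 1 ->
  d2 * d1 = onorm y -> d2 * d0 = onorm z -> omul (oreal d2) x = oconj (omul y z) ->
  is_OP2 (hmx d0 d1 d2 x y z).
Proof.
move=> d2n tr hy hz hx; set P := hmx _ _ _ _ _ _.
have hP : ohermitian P by exact: hmx_hermitian.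
have cx : omul (oreal d2) (oconj x) = omul y z.
  by rewrite -omulC_real -(oconj_real d2) -oconjM hx oconjK.
have nx : onorm x = d0 * d1.
  have := congr1 (@onorm R) hx; rewrite onorm_real onorm_conj onormM -hy -hz => h.
  by apply: (mulfI (expf_neq0 2 d2n)); rewrite h; ring.
have xz : omul (oconj x) (oconj z) = omul (oreal d0) y.
  apply: (omul_real_inj d2n); rewrite -omul_realAl cx omulK_conjr -hz.
  by rewrite omul_realA.
have yx : omul (oconj y) (oconj x) = omul (oreal d1) z.
  apply: (omul_real_inj d2n); rewrite -omul_realAr cx omulK_conjl -hy.
  by rewrite omul_realA.
have zy : omul (oconj z) (oconj y) = omul (oreal d2) x by rewrite hx oconjM.
split; first exact: hP.
split; last first.
  rewrite otrE !mxE /= !orealD tr; by [].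
(* The rank-one relations make each entry of the square the trace times the entry of [P]; Hermitian
   symmetry leaves six entries to check. *)
have P00 : omxmul P P 0 0 = P 0 0.
  rewrite omxmulE !mxE /= omul_real omul_conjr omul_conjl nx -hz !orealD.
  by congr oreal; rewrite -[RHS]mulr1 -tr; ring.
have P11 : omxmul P P 1 1 = P 1 1.
  rewrite omxmulE !mxE /= omul_real omul_conjr omul_conjl nx -hy !orealD.
  by congr oreal; rewrite -[RHS]mulr1 -tr; ring.
have P22 : omxmul P P 2%:R 2%:R = P 2%:R 2%:R.
  rewrite omxmulE !mxE /= omul_real omul_conjr omul_conjl -hy -hz !orealD.
  by congr oreal; rewrite -[RHS]mulr1 -tr; ring.
have P01 : omxmul P P 0 1 = P 0 1.
  rewrite omxmulE !mxE /= omulC_real zy !omul_realDl.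
  by rewrite tr omul1.
have P12 : omxmul P P 1 2%:R = P 1 2%:R.
  rewrite omxmulE !mxE /= omulC_real xz !omul_realDl.
  by rewrite tr omul1.
have P20 : omxmul P P 2%:R 0 = P 2%:R 0.
  rewrite omxmulE !mxE /= omulC_real yx !omul_realDl.
  by rewrite tr omul1.
have conjE i j : omxmul P P i j = P i j -> omxmul P P j i = P j i.
  by move=> h; rewrite hermitian_sqr_conj // h -hP.
have ordE : forall i : 'I_3, [\/ i = 0, i = 1 | i = 2%:R].
  by case=> [[|[|[|i]]] hi] //; [constructor 1|constructor 2|constructor 3]; exact/val_inj.
apply/matrixP => i j.
by case: (ordE i) => ->; case: (ordE j) => ->;
  rewrite ?(conjE _ _ P01) ?(conjE _ _ P12) ?(conjE _ _ P20).
Qed.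

Definition odot x y : R := ore (omul x (oconj y)).

Lemma oinner_hmx d0 d1 d2 x y z d0' d1' d2' x' y' z' :
  oinner (hmx d0 d1 d2 x y z) (hmx d0' d1' d2' x' y' z') =
  d0 * d0' + d1 * d1' + d2 * d2' + 2 * (odot x x' + odot y y' + odot z z').
Proof.
have oreD u v : ore (u + v : oct R) = ore u + ore v by [].
have oreR a b : ore (omul (oreal a) (oreal b)) = a * b by rewrite omul_real.
have odC u v : ore (omul (oconj u) v) = odot u v.
  by rewrite /odot ore_mulC -[omul v _]oconjK oconjM oconjK.
rewrite /oinner otrE !omxmulE !mxE /= !oreD !oreR !odC -!/(odot _ _) ; ring.
Qed.

End HermitianMatrices.

(** * The symmetry group *)

Section Isometries.
Variable R : realType.
Implicit Types (x y z : oct R) (P Q : omx R) (phi : oct R -> oct R).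

Definition oaut phi := [/\ {morph phi : x y / x + y}, {morph phi : x y / omul x y},
  {morph phi : x / oconj x}, forall a, phi (oreal a) = oreal a & forall x, ore (phi x) = ore x].

Lemma oaut_map_mul phi P Q : oaut phi ->
  map_mx phi (omxmul P Q) = omxmul (map_mx phi P) (map_mx phi Q).
Proof.
by case=> fD fM _ _ _; apply/matrixP => i j; rewrite mxE !omxmulE !mxE !fD !fM.
Qed.

Lemma oaut_map_tr phi P : oaut phi -> otr (map_mx phi P) = phi (otr P).
Proof. by case=> fD _ _ _ _; rewrite !otrE !mxE !fD. Qed.

Lemma oaut_OP2 phi P : oaut phi -> is_OP2 P -> is_OP2 (map_mx phi P).
Proof.
move=> hphi [hP [PP trP]]; have [fD fM fC fr fe] := hphi; split; [|split].
- by move=> i j; rewrite !mxE hP fC.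
- by rewrite -oaut_map_mul // PP.
- by rewrite oaut_map_tr // trP -/(oreal 1) fr.
Qed.

Lemma oaut_inner phi P Q : oaut phi ->
  oinner (map_mx phi P) (map_mx phi Q) = oinner P Q.
Proof.
move=> hphi; have [_ _ _ _ fe] := hphi.
by rewrite /oinner -oaut_map_mul // oaut_map_tr // fe.
Qed.

Lemma cyc3E : [/\ cyc3 0 = 1, cyc3 1 = 2%:R & cyc3 2%:R = 0].
Proof. by split; exact/val_inj. Qed.

Lemma cyc_shift_mul P Q : cyc_shift (omxmul P Q) = omxmul (cyc_shift P) (cyc_shift Q).
Proof.
have [c0 c1 c2] := cyc3E.
apply/matrixP => i j; rewrite mxE !omxmulE !mxE c0 c1 c2.
by rewrite [RHS]addrC addrA.
Qed.

Lemma cyc_shift_tr P : otr (cyc_shift P) = otr P.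
Proof. by have [c0 c1 c2] := cyc3E; rewrite !otrE !mxE c0 c1 c2 [LHS]addrC addrA. Qed.

Lemma cyc_shift_OP2 P : is_OP2 P -> is_OP2 (cyc_shift P).
Proof.
move=> [hP [PP trP]]; split; [|split].
- by move=> i j; rewrite !mxE hP.
- by rewrite -cyc_shift_mul PP.
- by rewrite cyc_shift_tr.
Qed.

Lemma cyc_shift_inner P Q : oinner (cyc_shift P) (cyc_shift Q) = oinner P Q.
Proof. by rewrite /oinner -cyc_shift_mul cyc_shift_tr. Qed.

Lemma cyc_shift3 P : cyc_shift (cyc_shift (cyc_shift P)) = P.
Proof.
apply/matrixP => i j; rewrite !mxE.
have c3 (k : 'I_3) : cyc3 (cyc3 (cyc3 k)) = k.
  by case: k => [[|[|[|k]]] hk] //; exact/val_inj.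
by rewrite !c3.
Qed.

Lemma cyc_shift_map phi P : cyc_shift (map_mx phi P) = map_mx phi (cyc_shift P).
Proof. by apply/matrixP => i j; rewrite !mxE. Qed.

Lemma cyc_shift_hmx d0 d1 d2 x y z :
  cyc_shift (hmx d0 d1 d2 x y z) = hmx d1 d2 d0 y z x.
Proof. by apply/matrixP => -[[|[|[|i]]] hi] [[|[|[|j]]] hj] //; rewrite !mxE. Qed.

Lemma oaut_hmx phi d0 d1 d2 x y z : oaut phi ->
  map_mx phi (hmx d0 d1 d2 x y z) = hmx d0 d1 d2 (phi x) (phi y) (phi z).
Proof.
case=> _ _ fC fr _.
by apply/matrixP => -[[|[|[|i]]] hi] [[|[|[|j]]] hj] //; rewrite !mxE /= ?fr ?fC.
Qed.

Lemma OP2_inner1 P : is_OP2 P -> oinner P P = 1.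
Proof. by move=> [_ [PP trP]]; rewrite /oinner PP trP. Qed.

(* [auta] and [autb] are signed permutations of the imaginary units that
   generate a dihedral group of order 8 of automorphisms. *)
Definition auta (x : oct R) : oct R :=
  let: (((x0, x1), (x2, x3)), ((x4, x5), (x6, x7))) := x in
  (((x0, x4), (- x2, x6)), ((- x1, x5), (- x3, - x7))).

Definition autb (x : oct R) : oct R :=
  let: (((x0, x1), (x2, x3)), ((x4, x5), (x6, x7))) := x in
  (((x0, x6), (x2, x4)), ((x3, - x5), (x1, - x7))).

Lemma auta_oaut : oaut auta.
Proof.
split=> [x y|x y|x|a|x].
- move: x y => [[[x0 x1] [x2 x3]] [[x4 x5] [x6 x7]]] [[[y0 y1] [y2 y3]] [[y4 y5] [y6 y7]]].
  rewrite /auta; octring.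
- move: x y => [[[x0 x1] [x2 x3]] [[x4 x5] [x6 x7]]] [[[y0 y1] [y2 y3]] [[y4 y5] [y6 y7]]].
  rewrite omulE /auta; octring.
- by move: x => [[[x0 x1] [x2 x3]] [[x4 x5] [x6 x7]]].
- by rewrite /auta /oreal !oppr0.
- by move: x => [[[x0 x1] [x2 x3]] [[x4 x5] [x6 x7]]].
Qed.

Lemma autb_oaut : oaut autb.
Proof.
split=> [x y|x y|x|a|x].
- move: x y => [[[x0 x1] [x2 x3]] [[x4 x5] [x6 x7]]] [[[y0 y1] [y2 y3]] [[y4 y5] [y6 y7]]].
  rewrite /autb; octring.
- move: x y => [[[x0 x1] [x2 x3]] [[x4 x5] [x6 x7]]] [[[y0 y1] [y2 y3]] [[y4 y5] [y6 y7]]].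
  rewrite omulE /autb; octring.
- by move: x => [[[x0 x1] [x2 x3]] [[x4 x5] [x6 x7]]].
- by rewrite /autb /oreal !oppr0.
- by move: x => [[[x0 x1] [x2 x3]] [[x4 x5] [x6 x7]]].
Qed.

Lemma auta4 x : auta (auta (auta (auta x))) = x.
Proof. by move: x => [[[x0 x1] [x2 x3]] [[x4 x5] [x6 x7]]]; rewrite /auta !opprK. Qed.

Lemma autb2 x : autb (autb x) = x.
Proof. by move: x => [[[x0 x1] [x2 x3]] [[x4 x5] [x6 x7]]]; rewrite /autb !opprK. Qed.

(** The dihedral relation, with the inverse of [auta] written as its cube. *)
Lemma autab x : auta (autb x) = autb (auta (auta (auta x))).
Proof. by move: x => [[[x0 x1] [x2 x3]] [[x4 x5] [x6 x7]]]; rewrite /auta /autb !opprK. Qed.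

Local Notation A := (map_mx auta).
Local Notation B := (map_mx autb).
Local Notation C := (@cyc_shift R).

Definition orbit_point P s m t : omx R := iter s B (iter m A (iter t C P)).

Lemma iterA4 P n : iter (4 * n) A P = P.
Proof.
elim: n => // n ih; rewrite mulnS iterD ih /= -!map_mx_comp.
by apply/matrixP => i j; rewrite mxE /= auta4.
Qed.

Lemma iterB2 P n : iter (2 * n) B P = P.
Proof.
elim: n => // n ih; rewrite mulnS iterD ih /= -!map_mx_comp.
by apply/matrixP => i j; rewrite mxE /= autb2.
Qed.

Lemma iterC3 P n : iter (3 * n) C P = P.
Proof. by elim: n => // n ih; rewrite mulnS iterD ih /= cyc_shift3. Qed.

(** Moving a rotation past one reflection inverts it, that is, multiplies its exponent by 3 modulo
    4. *)
Lemma iterAB P m s : iter m A (iter s B P) = iter s B (iter (3 ^ s * m) A P).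
Proof.
have AB Q : A (B Q) = B (iter 3 A Q).
  by rewrite /= -!map_mx_comp; apply/matrixP => i j; rewrite !mxE /= autab.
have AB1 n Q : iter n A (B Q) = B (iter (3 * n) A Q).
  by elim: n Q => // n ih Q; rewrite iterS ih AB -iterD mulnS.
elim: s m P => [|s ih] m P; first by rewrite mul1n.
by rewrite iterS AB1 ih expnSr mulnA.
Qed.

Lemma iterCA P m t : iter t C (iter m A P) = iter m A (iter t C P).
Proof.
elim: t => // t ih; rewrite iterS ih.
by elim: m {ih} => // m ih; rewrite !iterS cyc_shift_map ih.
Qed.

Lemma iterCB P s t : iter t C (iter s B P) = iter s B (iter t C P).
Proof.
elim: t => // t ih; rewrite iterS ih.
by elim: s {ih} => // s ih; rewrite !iterS cyc_shift_map ih.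
Qed.

Lemma iter_inner (f : omx R -> omx R) n P Q :
  (forall P Q, oinner (f P) (f Q) = oinner P Q) -> oinner (iter n f P) (iter n f Q) = oinner P Q.
Proof. by move=> h; elim: n => // n ih; rewrite !iterS h. Qed.

(** For isometries [g], [h] the inner product of [g P] and [h P] is that of [P] and [g^-1 h P]; the
    right side is the normal form of [g^-1 h], with inverses written as the powers 1, 3, 2 of
    generators of orders 2, 4, 3. *)
Lemma orbit_inner P s m t s' m' t' :
  oinner (orbit_point P s m t) (orbit_point P s' m' t') =
  oinner P (orbit_point P ((s + s') %% 2)
    ((3 ^ (s + s') * (3 * m) + m') %% 4) ((2 * t + t') %% 3)).
Proof.
have hA := fun P Q => oaut_inner P Q auta_oaut.
have hB := fun P Q => oaut_inner P Q autb_oaut.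
have modA n Q : iter (n %% 4) A Q = iter n A Q.
  by rewrite [in RHS](divn_eq n 4) addnC mulnC iterD iterA4.
have modB n Q : iter (n %% 2) B Q = iter n B Q.
  by rewrite [in RHS](divn_eq n 2) addnC mulnC iterD iterB2.
have modC n Q : iter (n %% 3) C Q = iter n C Q.
  by rewrite [in RHS](divn_eq n 3) addnC mulnC iterD iterC3.
rewrite /orbit_point modA modB modC.
(* Inserting the trivial power [2 * s] on the right lets one [s] cancel against the left while the
   other acts as the inverse. The same is done for [A] and [C]. *)
rewrite -[iter s' B _](iterB2 _ s) mul2n -addnn iterD (iter_inner _ _ _ hB) -iterD.
rewrite -[iter (s + s') B _](iterA4 _ m) (_ : 4 * m = m + 3 * m)%N // iterD.
rewrite (iter_inner _ _ _ hA) iterAB -iterD.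
rewrite -[iter (s + s') B _](iterC3 _ t) (_ : 3 * t = t + 2 * t)%N // iterD.
by rewrite (iter_inner _ _ _ cyc_shift_inner) iterCB iterCA -iterD.
Qed.

Lemma orbit_point_OP2 P s m t : is_OP2 P -> is_OP2 (orbit_point P s m t).
Proof.
move=> hP; rewrite /orbit_point; elim: s => [|s ih]; last exact/oaut_OP2/ih/autb_oaut.
elim: m => [|m ih] /=; last exact/oaut_OP2/ih/auta_oaut.
by elim: t => // t ih; exact: cyc_shift_OP2.
Qed.

End Isometries.

(** * The base point and its orbit *)

Section SimplexPoint.
Variable R : realType.
Implicit Types e : nat -> R.

(* [x], [y], [z] are the entries (0,1), (1,2), (2,0). For each imaginary unit, the
   sum of its three coefficients and their cyclic correlation are the isotypic
   weights. The gauge makes e_1 the only unit among e_1, e_3, e_4, e_6 whose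
   three coefficients have nonzero sum (namely [3 * e 8]). *)
Definition simplex_x e : oct R :=
  (((e 2%N, e 8%N), (e 9%N, - (2 * e 6%N))), ((0, e 12%N), (- (2 * e 7%N), e 15%N))).
Definition simplex_y e : oct R :=
  (((e 3%N, e 8%N + e 4%N), (e 10%N, e 6%N)), ((e 5%N, e 13%N), (e 7%N, e 16%N))).
Definition simplex_z e : oct R :=
  (((- (e 2%N + e 3%N), e 8%N - e 4%N), (e 11%N, e 6%N)), ((- e 5%N, e 14%N), (e 7%N, e 17%N))).
(** The off-diagonal real parts sum to zero: the projection of [P] to the group invariants must have
    squared norm [(1 + 23 * (7 / 23)) / 24 = 1 / 3], which the trace part, a third of the identity,
    already supplies. *)
Definition simplex_point e : omx R :=
  hmx (e 0%N) (e 1%N) (1 - e 0%N - e 1%N) (simplex_x e) (simplex_y e) (simplex_z e).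

Let zr_literal : (zr R (Zpos 1) = 1) * (zr R (Zneg 1) = -1) * (zr R (Zpos 2) = 2) *
  (zr R (Zneg 2) = -2) * (zr R (Zneg 4) = -4) * (zr R (Zpos 23) = 23) *
  (zr R (Zpos 46) = 46) * (zr R (Zpos 69) = 69) * (zr R (Zpos 138) = 138) *
  (zr R (Zpos 207) = 207).
Proof. by []. Qed.

Definition simplex_root e : Prop :=
  [/\ e 18%N = 1, 0 < 1 - e 0%N - e 1%N &
    forall r, (r < 18)%N -> qeval (@zr R) e (nth [::] simplex_system r) = 0].

(** Up to sign, equations 0 to 7 are the coordinates of [d2 x = conj(y z)], while 8 and 9 are the
    norm conditions of [hmx_OP2] on [z] and [y]. *)
Lemma simplex_point_OP2 e : simplex_root e -> is_OP2 (simplex_point e).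
Proof.
move=> [e1 d2 eS].
have eqn r (hr : (r < 18)%N) := eS r hr.
have H0 := eqn 0%N isT; have H1 := eqn 1%N isT; have H2 := eqn 2%N isT.
have H3 := eqn 3%N isT; have H4 := eqn 4%N isT; have H5 := eqn 5%N isT.
have H6 := eqn 6%N isT; have H7 := eqn 7%N isT; have H8 := eqn 8%N isT.
have H9 := eqn 9%N isT.
rewrite /qeval /= !zr_literal e1 in H0 H1 H2 H3 H4 H5 H6 H7 H8 H9.
apply: hmx_OP2.
- by rewrite gt_eqF.
- by ring.
- rewrite /simplex_y /onorm oconjE omulE /ore /=. lra.
- rewrite /simplex_z /onorm oconjE omulE /ore /=. lra.
- rewrite /oreal /simplex_x /simplex_y /simplex_z !omulE !oconjE.
  repeat match goal with |- (_, _) = (_, _) => apply: f_equal2 end; lra.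
Qed.

Lemma simplex_point_inner e s m t : simplex_root e ->
  (s < 2)%N -> (m < 4)%N -> (t < 3)%N -> (0 < s + m + t)%N ->
  oinner (simplex_point e) (orbit_point (simplex_point e) s m t) = 7 / 23.
Proof.
move=> re; have N := OP2_inner1 (simplex_point_OP2 re); have [e1 _ eS] := re.
have eqn r (hr : (r < 18)%N) := eS r hr.
have H0 := eqn 10%N isT; have H1 := eqn 11%N isT; have H2 := eqn 12%N isT.
have H3 := eqn 13%N isT; have H4 := eqn 14%N isT; have H5 := eqn 15%N isT.
have H6 := eqn 16%N isT; have H7 := eqn 17%N isT.
rewrite /qeval /= !zr_literal e1 in H0 H1 H2 H3 H4 H5 H6 H7.
rewrite /orbit_point /simplex_point in N *.
rewrite oinner_hmx in N.
have hA := @oaut_hmx R _ _ _ _ _ _ _ (auta_oaut R).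
have hB := @oaut_hmx R _ _ _ _ _ _ _ (autb_oaut R).
rewrite /odot /simplex_x /simplex_y /simplex_z !oconjE !omulE /ore /= in N.
case: s => [|[|s]] //; case: m => [|[|[|[|m]]]] //; case: t => [|[|[|t]]] // _ _ _ _;
  rewrite /= ?cyc_shift_hmx ?hA ?hB oinner_hmx /odot /simplex_x /simplex_y /simplex_z
    /auta /autb !oconjE !omulE /ore /=; lra.
Qed.

End SimplexPoint.

(** An index is read as [i = 12 s + 3 m + t]. Two coinciding points would have inner product 1
    instead of 7/23, so the orbit is regular. *)
Lemma orbit_tight_simplex (R : realType) (P : omx R) : is_OP2 P ->
  (forall s m t, (s < 2)%N -> (m < 4)%N -> (t < 3)%N -> (0 < s + m + t)%N ->
     oinner P (orbit_point P s m t) = 7 / 23) ->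
  let Q (i : 'I_24) := orbit_point P (i %/ 12) ((i %/ 3) %% 4) (i %% 3) in
  tight_simplex Q /\ forall i, exists j, cyc_shift (Q i) = Q j.
Proof.
move=> hP hin Q.
have QP i : is_OP2 (Q i) by exact: orbit_point_OP2.
(* For distinct indices the normal form of [g^-1 h] has a nonzero exponent, checked on all pairs. *)
have dist : (all (fun i => all (fun j => (i == j) || (0 <
    (i %/ 12 + j %/ 12) %% 2 +
    (3 ^ (i %/ 12 + j %/ 12) * (3 * ((i %/ 3) %% 4)) + (j %/ 3) %% 4) %% 4 +
    (2 * (i %% 3) + j %% 3) %% 3)) (iota 0 24)) (iota 0 24))%N by vm_compute.
have Qin i j : i != j -> oinner (Q i) (Q j) = 7 / 23.
  move=> ij; rewrite /Q orbit_inner; apply: hin; rewrite ?ltn_mod //.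
  move/allP: dist => /(_ (val i)); rewrite mem_iota ltn_ord => /(_ isT) /allP /(_ (val j)).
  by rewrite mem_iota ltn_ord => /(_ isT); rewrite val_eqE (negPf ij).
split; last first.
  (* The shift commutes with the dihedral group, so it only advances the last digit [t] modulo 3. *)
  move=> i; have ht : (3 * (i %/ 3) + (i %% 3).+1 %% 3 < 24)%N.
    by have := ltn_ord i; lia.
  exists (Ordinal ht); rewrite /Q /orbit_point /=.
  set j := (3 * (i %/ 3) + _)%N.
  have -> : (j %/ 12 = i %/ 12)%N by rewrite /j; lia.
  have -> : (j %/ 3 = i %/ 3)%N by rewrite /j; lia.
  have -> : (j %% 3 = (i %% 3).+1 %% 3)%N by rewrite /j; lia.
  rewrite -[LHS]/(iter 1 (@cyc_shift R) _) iterCB iterCA -iterS.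
  have : (i %% 3 < 3)%N by rewrite ltn_mod.
  by case: (i %% 3)%N => [|[|[|k]]] //= _; rewrite cyc_shift3.
split; [exact: QP|split].
- move=> i j Qij; apply/eqP/negPn/negP => /Qin; rewrite Qij OP2_inner1 //.
  lra.
- by move=> i j /Qin ->; field.
Qed.

Theorem theorem5p4 (R : realType) :
  (exists P : 'I_24 -> omx R, tight_simplex P) /\
  (exists P : 'I_24 -> omx R, tight_simplex P /\
     forall i : 'I_24, exists j : 'I_24, cyc_shift (P i) = P j).
Proof.
have [e re] := simplex_system_solvable R.
have [ts cyc] := orbit_tight_simplex (simplex_point_OP2 re)
  (fun s m t => @simplex_point_inner R e s m t re).
by split; eexists; [exact: ts|split; [exact: ts|exact: cyc]].
Qed.
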